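(* Let $L$ be a cyclic infinite dimensional Leibniz algebra over a field $F$. Then the Lie algebra $\mathbf{Der}(L)$ of all derivations of $L$ satisfies the following conditions: (i) $\mathbf{Der}(L)$ includes an abelian ideal $$A=\{f\mid f\in\mathbf{Der}(L)\text{ and } f(x)\in[L,L]\text{ for all }x\in L\}$$ and an abelian subalgebra $D$ such that $\mathbf{Der}(L)=A+D$ and $A\cap D=\langle 0\rangle$; (ii) $D$ is isomorphic to the field $F$; (iii) if $\mathbf{char}(F)=0$, then $[d,A]=A$ for each element $d\in D$.
   Context: A (left) Leibniz algebra over a field $F$ is an $F$-vector space $L$ with a bilinear operation $[\cdot,\cdot]$ satisfying $[a,[b,c]]=[[a,b],c]+[b,[a,c]]$ for all $a,b,c\in L$. It is cyclic if it is generated, as an algebra, by a single element. $[L,L]$ is the linear span of all products $[x,y]$, $x,y\in L$. A derivation of $L$ is an $F$-linear map $f:L\to L$ with $f([a,b])=[f(a),b]+[a,f(b)]$ for all $a,b\in L$. The set $\mathbf{Der}(L)$ of all derivations is a Lie subalgebra of the Lie algebra of all linear transformations of $L$ with the bracket $[f,g]=f\circ g-g\circ f$. For $d\in D$, $[d,A]=\{[d,f]\mid f\in A\}$. A Lie algebra is abelian if its bracket is identically zero. In (ii), $F$ is regarded as a one-dimensional abelian Lie algebra over itself.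
   Formalization: In (iii), ''for each element d in D'' is read as ''for each nonzero d in D'': for d = 0 one has [0,A] = 0, while A is nonzero because it contains left multiplication by the generator. *)

(* Defs.v *)
From HB Require Import structures.
From mathcomp Require Import all_boot all_order all_algebra.
From mathcomp Require Import boolp classical_sets functions.

Set Implicit Arguments.
Unset Strict Implicit.
Unset Printing Implicit Defensive.

Import GRing.Theory.
Local Open Scope classical_set_scope.
Local Open Scope ring_scope.

Section LinearAlgebra.
Variables (F : fieldType) (V : lmodType F).

Definition lspan (S : set V) : set V :=
  [set v | exists n (c : 'I_n -> F) (e : 'I_n -> V),
     (forall i, S (e i)) /\ v = \sum_(i < n) c i *: e i].

Definition finite_dimensional : Prop :=
  exists s : seq V, lspan [set` s] = setT.

End LinearAlgebra.

(* An algebra is a vector space V with a product br; bilinearity of br is not *)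
(* built into the next definitions, because they are also applied to the      *)
(* commutator on the space L -> L of all maps, which is bilinear only on the  *)
(* linear ones.                                                               *)
Section Algebras.
Variables (F : fieldType) (V : lmodType F) (br : V -> V -> V).

Definition subalgebra (S : set V) : Prop :=
  submod_closed [in S] /\ (forall x y, S x -> S y -> S (br x y)).

Definition ideal_of (S I : set V) : Prop :=
  [/\ I `<=` S, submod_closed [in I]
    & forall x y, S x -> I y -> I (br x y) /\ I (br y x)].

Definition abelian_bracket (S : set V) : Prop :=
  forall x y, S x -> S y -> br x y = 0.

Definition generated_subalgebra (G : set V) : set V := smallest subalgebra G.

Definition cyclic_algebra : Prop :=
  exists a : V, generated_subalgebra [set a] = setT.

Definition derived_space : set V :=
  lspan [set z | exists x y, z = br x y].

Definition left_leibniz : Prop :=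
  forall a b c, br a (br b c) = br (br a b) c + br b (br a c).

Definition Der : set (V -> V) :=
  [set f | linear f /\ forall a b, f (br a b) = br (f a) b + br a (f b)].

Definition DerA : set (V -> V) :=
  [set f | Der f /\ forall x, derived_space (f x)].

End Algebras.

(* Isomorphism of the subalgebra S of (V, brV) with the subalgebra T of       *)
(* (W, brW); only the restriction of phi to S matters.                        *)
Definition isomorphic_subalgebras (F : fieldType) (V W : lmodType F)
    (brV : V -> V -> V) (S : set V) (brW : W -> W -> W) (T : set W) : Prop :=
  exists phi : V -> W,
    [/\ set_bij S T phi,
        forall c x y, S x -> S y -> phi (c *: x + y) = c *: phi x + phi y
      & forall x y, S x -> S y -> phi (brV x y) = brW (phi x) (phi y)].

Definition commutator (F : fieldType) (V : lmodType F) (f g : V -> V) : V -> V :=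
  (f \o g) - (g \o f).

Definition zero_bracket (V : nmodType) (x y : V) : V := 0.

Lemma Der_subalgebra (F : fieldType) (V : lmodType F)
    (br : {bilinear V -> V -> V}) : subalgebra (@commutator F V) (Der br).
Proof.
have E0 x : (0 : V -> V) x = 0 by [].
have EL c (f g : V -> V) x : (c *: f + g) x = c *: f x + g x by [].
have EC (f g : V -> V) x : commutator f g x = f (g x) - g (f x) by [].
have linD (f : V -> V) : linear f -> {morph f : x y / x + y}.
  by move=> lf x y; have := lf 1 x y; rewrite !scale1r.
split; first split.
- rewrite inE; split=> [c u v|a b]; rewrite !E0; first by rewrite scaler0 addr0.
  by rewrite linear0l linear0r addr0.
- move=> c f g; rewrite !inE => -[lf df] [lg dg].
  split=> [k u v|a b]; rewrite !EL.
    by rewrite lf lg !scalerDr !scalerA mulrC addrACA.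
  by rewrite df dg linearPl linearPr scalerDr addrACA.
- move=> f g [lf df] [lg dg]; split=> [k u v|a b]; rewrite !EC.
    by rewrite lg lf lf lg opprD addrACA scalerBr.
  rewrite df dg (linD f lf) (linD g lg) !df !dg linearBl linearBr.
  move: (br (f (g a)) b) (br (g a) (f b)) (br (f a) (g b)) => p q r.
  move: (br a (f (g b))) (br (g (f a)) b) (br a (g (f b))) => s t u.
  rewrite (addrC p q) (addrC t r) (addrACA q p r s) (addrACA r t q u) (addrC r q).
  by rewrite opprD [LHS]addrACA subrr add0r opprD [LHS]addrACA.
Qed.

(* Main.v *)
From HB Require Import structures.
Require Import Defs.
From mathcomp Require Import all_boot all_order all_algebra.
From mathcomp Require Import boolp classical_sets functions.
From mathcomp Require Import ring.

(** Let [a] generate [L].  By the Leibniz identity [br a a], and with it every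
    iterated product of two or more copies of [a], acts trivially
    from the left; so only the multiples of [a] count as left factors
    ([br_pow_map]), and [p |-> p(br a) a] maps [{poly F}] onto [L]
    ([pow_map_surj]).  A nonzero polynomial in the kernel would bound the
    dimension of [L], by Euclidean division ([pow_map_inj]).  Hence an
    infinite dimensional cyclic [L] is [{poly F}] with the product [p(0) X q],
    whose derived space is the ideal [(X)].

    A derivation is determined by the image [p] of the generator [1], and the
    Leibniz rule gives it as [q |-> p q + p(0) X q']; conversely this formula
    defines a derivation for every [p] ([DerP]).  So [Der L] is [{poly F}] again,
    now with the bracket [p(0) X r' - r(0) X p'] ([commutator_der_of]).  In these
    coordinates the theorem can be read off: [A] is the ideal [(X)], where the
    bracket vanishes, [D] is the line of constant polynomials, and a constant [c]
    acts on [(X)] by [c X d/dX], which multiplies [X^i] by [c i]; for [c] nonzero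
    this is invertible on [(X)] in characteristic 0. *)

Set Implicit Arguments.
Unset Strict Implicit.
Unset Printing Implicit Defensive.

Import GRing.Theory.
Local Open Scope classical_set_scope.
Local Open Scope ring_scope.

(** * Cyclic Leibniz algebras as images of the polynomial algebra *)

Section PowerMap.
Variables (F : fieldType) (L : lmodType F) (br : {bilinear L -> L -> L}).
Variable a : L.

(** The action of [p] on [a], when ['X] acts by left multiplication by [a].  Only
    the powers [br a (br a ...)] occur: a product of copies of [a] whose left
    factor has more than one of them vanishes in a Leibniz algebra. *)
Definition pow_map (p : {poly F}) : L :=
  \sum_(i < size p) p`_i *: iter i (br a) a.

Lemma pow_map_widen n (p : {poly F}) : (size p <= n)%N ->
  pow_map p = \sum_(i < n) p`_i *: iter i (br a) a.
Proof.
move=> le_pn; rewrite /pow_map (big_ord_widen n (fun i => p`_i *: iter i (br a) a)) //.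
rewrite big_mkcond; apply: eq_bigr => i _.
by case: ltnP => // le_pi; rewrite nth_default ?scale0r.
Qed.

Lemma pow_map_is_linear : linear pow_map.
Proof.
move=> c p q.
set n := maxn (size (c *: p + q)) (maxn (size p) (size q)).
rewrite !(@pow_map_widen n) ?leq_max ?leqnn ?orbT //.
rewrite scaler_sumr -big_split; apply: eq_bigr => i _ /=.
by rewrite coefD coefZ scalerDl scalerA.
Qed.

HB.instance Definition _ :=
  GRing.isLinear.Build F {poly F} L *:%R pow_map pow_map_is_linear.

Lemma pow_map1 : pow_map 1 = a.
Proof. by rewrite /pow_map size_poly1 big_ord1 coefC scale1r. Qed.

Lemma pow_mapXM (p : {poly F}) : pow_map ('X * p) = br a (pow_map p).
Proof.
have szX : (size ('X * p)%R <= (size p).+1)%N.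
  by rewrite (leq_trans (size_polyMleq _ _)) // size_polyX.
rewrite (pow_map_widen szX) big_ord_recl coefXM scale0r add0r linear_sumr.
by apply: eq_bigr => i _; rewrite coefXM linearZr.
Qed.

Lemma pow_map_eq0M u p : pow_map p = 0 -> pow_map (u * p) = 0.
Proof.
move=> p0; elim/poly_ind: u => [|u c IHu]; first by rewrite mul0r linear0.
rewrite mulrDl mul_polyC linearD linearZ /= p0 scaler0 addr0.
by rewrite mulrAC mulrC pow_mapXM IHu linear0r.
Qed.

Hypothesis leibL : left_leibniz br.

(** The square of [a] acts trivially from the left, since
    [br a (br a y) = br (br a a) y + br a (br a y)]; and the elements that act
    trivially from the left are stable under left multiplication. *)
Lemma br_pow_mapXM p y : br (pow_map ('X * p)) y = 0.
Proof.
have sq0 z : br (br a a) z = 0.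
  by apply/eqP; rewrite -(inj_eq (addIr (br a (br a z)))) -leibL add0r.
elim/poly_ind: p y => [|p c IHp] y; first by rewrite mulr0 linear0 linear0l.
rewrite pow_mapXM linearD /= linearDr linearDl.
rewrite -[c%:P]mulr1 mul_polyC linearZ linearZr_LR linearZl_LR /= pow_map1 sq0.
rewrite scaler0 addr0 mulrC.
apply/eqP; rewrite -(inj_eq (addIr (br (pow_map ('X * p)) (br a y)))).
by rewrite -leibL !IHp linear0r addr0.
Qed.

Lemma br_pow_map p q : br (pow_map p) (pow_map q) = pow_map (p`_0 *: ('X * q)).
Proof.
elim/poly_ind: p => [|p c _]; first by rewrite linear0 linear0l coef0 scale0r linear0.
rewrite linearD linearDl mulrC br_pow_mapXM add0r coefD coefXM coefC add0r /=.
rewrite -[c%:P]mulr1 mul_polyC !linearZ linearZl_LR /= pow_map1 pow_mapXM //.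
Qed.

Lemma pow_map_surj : generated_subalgebra br [set a] = setT ->
  forall x, exists p, pow_map p = x.
Proof.
move=> gen x.
suff sub : generated_subalgebra br [set a] `<=` range pow_map.
  by have [|p _ <-] := sub x; [rewrite gen | exists p].
apply: smallest_sub; last by move=> _ ->; exists 1; rewrite ?pow_map1.
split=> [|_ _ [p _ <-] [q _ <-]]; last first.
  by exists (p`_0 *: ('X * q)); rewrite ?br_pow_map.
split=> [|c _ _ /set_mem[p _ <-] /set_mem[q _ <-]]; apply/mem_set.
  by exists 0; rewrite ?linear0.
by exists (c *: p + q); rewrite ?linearP.
Qed.

(** The kernel is an ideal of [{poly F}]; modulo a nonzero [p] in it, each
    polynomial reduces to one of size less than that of [p], so finitely many
    powers of [a] span. *)
Lemma pow_map_inj : (forall x, exists p, pow_map p = x) ->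
  ~ finite_dimensional L -> injective pow_map.
Proof.
move=> surj infL; apply: raddf_inj => p p0; apply/eqP/negPn/negP => nz_p.
apply: infL; exists [seq iter i (br a) a | i <- iota 0 (size p)].
rewrite -subTset => x _; have [q <-] := surj x.
rewrite (divp_eq q p) linearD /= pow_map_eq0M // add0r.
exists (size p), (fun i => (q %% p)`_i), (fun i => iter i (br a) a); split.
  by move=> i; apply: (map_f (fun j => iter j (br a) a)); rewrite mem_iota ltn_ord.
by rewrite -pow_map_widen // ltnW // ltn_modp.
Qed.

End PowerMap.

(** * Derivations in polynomial coordinates *)

Section PolynomialModel.
Variables (F : fieldType) (L : lmodType F) (br : {bilinear L -> L -> L}).
Variables (Phi : {linear {poly F} -> L}) (Psi : L -> {poly F}).
Hypotheses (PhiK : cancel Phi Psi) (PsiK : cancel Psi Phi).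
Hypothesis br_Phi : forall p q, br (Phi p) (Phi q) = Phi (p`_0 *: ('X * q)).

Implicit Types (p q r : {poly F}) (f : L -> L).

Lemma derived_spaceP p : derived_space br (Phi p) <-> p`_0 = 0.
Proof.
split=> [[n [c [e [brE defp]]]]|p0].
  have -> : p = \sum_(i < n) c i *: Psi (e i).
    apply: (can_inj PhiK); rewrite defp linear_sum; apply: eq_bigr => i _.
    by rewrite linearZ /= PsiK.
  rewrite coef_sum big1 // => i _; have [x [y ->]] := brE i.
  rewrite -[x]PsiK -[y]PsiK br_Phi PhiK !coefZ coefXM.
  by rewrite !mulr0.
exists 1, (fun=> 1), (fun=> Phi p); split; last first.
  by rewrite big_ord1 scale1r.
move=> _; exists (Phi 1), (Phi (p %/ 'X)).
rewrite br_Phi coefC scale1r mulrC divpK //.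
by rewrite -['X]subr0 dvdp_XsubCl /root horner_coef0 p0.
Qed.

(** The derivation of the product [p(0) X q] that sends the generator [1] to
    [p]. *)
Definition poly_der p q : {poly F} := q * p + p`_0 *: ('X * q^`()).

Definition der_of p : L -> L := fun x => Phi (poly_der p (Psi x)).

Lemma der_ofE p q : der_of p (Phi q) = Phi (poly_der p q).
Proof. by rewrite /der_of PhiK. Qed.

Lemma poly_der1 p : poly_der p 1 = p.
Proof. by rewrite /poly_der mul1r derivC mulr0 scaler0 addr0. Qed.

Lemma poly_der0M p q : (poly_der p q)`_0 = q`_0 * p`_0.
Proof. by rewrite coefD coefZ coefXM mulr0 addr0 coef0M. Qed.

Lemma poly_der_linear p : linear (poly_der p).
Proof.
move=> c q r; rewrite /poly_der derivD derivZ -!mul_polyC.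
by ring.
Qed.

Lemma poly_der_leibniz p q r :
  poly_der p (q`_0 *: ('X * r)) =
    (poly_der p q)`_0 *: ('X * r) + q`_0 *: ('X * poly_der p r).
Proof.
rewrite poly_der0M /poly_der derivZ derivM derivX -!mul_polyC polyCM.
by ring.
Qed.

Lemma der_of_is_linear : linear der_of.
Proof.
move=> c p q; apply/funext => x.
change (Phi (poly_der (c *: p + q) (Psi x)) =
  c *: Phi (poly_der p (Psi x)) + Phi (poly_der q (Psi x))).
rewrite -linearP; congr (Phi _); rewrite /poly_der coefD coefZ -!mul_polyC.
by rewrite !(polyCD, polyCM); ring.
Qed.

HB.instance Definition _ :=
  GRing.isLinear.Build F {poly F} (L -> L) *:%R der_of der_of_is_linear.

Lemma Der_der_of p : Der br (der_of p).
Proof.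
split=> [c x y|x y]; rewrite -[x]PsiK -[y]PsiK.
  by rewrite -linearP !der_ofE -linearP poly_der_linear.
by rewrite br_Phi !der_ofE !br_Phi -linearD poly_der_leibniz.
Qed.

(** The polynomial [X q] is the product of [1] and [q], so the Leibniz rule gives
    [f (X q)] from [f 1] and [f q]; hence [f 1] determines [f]. *)
Lemma der_of_gen f : Der br f -> f = der_of (Psi (f (Phi 1))).
Proof.
move=> [lin_f der_f]; set p := Psi _; apply/funext => x; rewrite -[x]PsiK.
have brX q : Phi ('X * q) = br (Phi 1) (Phi q) by rewrite br_Phi coefC scale1r.
have lin0 (g : L -> L) : linear g -> g 0 = 0.
  by move=> lin_g; have := lin_g (-1) 0 0; rewrite scaler0 addr0 scaleN1r addNr.
have [lin_d der_d] := Der_der_of p.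
elim/poly_ind: (Psi x) => [|q c IHq]; first by rewrite linear0 !lin0.
rewrite addrC -[c%:P]mulr1 mul_polyC linearP [q * _]mulrC brX lin_f lin_d.
by rewrite der_f der_d IHq (der_ofE p 1) poly_der1 PsiK.
Qed.

Lemma DerP f : Der br f <-> exists p, f = der_of p.
Proof.
split=> [/der_of_gen ->|[p ->]]; first by eexists.
exact: Der_der_of.
Qed.

Lemma DerA_der_of p : DerA br (der_of p) <-> p`_0 = 0.
Proof.
split=> [[_ /(_ (Phi 1))]|p0].
  by rewrite der_ofE poly_der1 => /derived_spaceP.
by split=> [|x]; [exact: Der_der_of | apply/derived_spaceP; rewrite poly_der0M p0 mulr0].
Qed.

Lemma DerAP f : DerA br f <-> exists2 p, f = der_of p & p`_0 = 0.
Proof.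
split=> [Af|[p -> /DerA_der_of //]].
by have /DerP[p fE] := Af.1; exists p => //; apply/DerA_der_of; rewrite -fE.
Qed.

(** Both sides are derivations, so it suffices to compare them at the generator,
    where the commutator gives [poly_der p r - poly_der r p]; the products [p r]
    cancel. *)
Lemma commutator_der_of p r : commutator (der_of p) (der_of r) =
  der_of (p`_0 *: ('X * r^`()) - r`_0 *: ('X * p^`())).
Proof.
have [_ derC] := Der_subalgebra br.
rewrite (der_of_gen (derC _ _ (Der_der_of p) (Der_der_of r))); congr der_of.
change (Psi (der_of p (der_of r (Phi 1)) - der_of r (der_of p (Phi 1))) =
  p`_0 *: ('X * r^`()) - r`_0 *: ('X * p^`())).
rewrite !der_ofE !poly_der1 -linearB PhiK /poly_der.
by rewrite -!mul_polyC; ring.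
Qed.

Lemma commutator_der_ofC c r :
  commutator (der_of c%:P) (der_of r) = der_of (c *: ('X * r^`())).
Proof. by rewrite commutator_der_of coefC derivC mulr0 scaler0 subr0. Qed.

(** * The decomposition of the derivation algebra *)

Definition DerD : set (L -> L) := [set der_of c%:P | c in [set: F]].

Lemma DerA_ideal : ideal_of (@commutator F L) (Der br) (DerA br).
Proof.
split=> [f []//||f g /DerP[p ->] /DerAP[r -> r0]].
  split=> [|c f g /set_mem/DerAP[p -> p0] /set_mem/DerAP[q -> q0]]; apply/mem_set.
    by rewrite -(linear0 der_of); apply/DerA_der_of; rewrite coef0.
  by rewrite -linearP; apply/DerA_der_of; rewrite coefD coefZ p0 q0 mulr0 addr0.
by rewrite !commutator_der_of; split; apply/DerA_der_of;
  rewrite coefB !coefZ !coefXM !mulr0 subr0.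
Qed.

Lemma DerA_abelian : abelian_bracket (@commutator F L) (DerA br).
Proof.
move=> f g /DerAP[p -> p0] /DerAP[r -> r0].
by rewrite commutator_der_of p0 r0 !scale0r subr0 linear0.
Qed.

Lemma DerD_abelian : abelian_bracket (@commutator F L) DerD.
Proof.
move=> f g [c _ <-] [d _ <-].
by rewrite commutator_der_ofC derivC mulr0 scaler0 linear0.
Qed.

Lemma DerD_submod : submod_closed [in DerD].
Proof.
split=> [|c f g /set_mem[d _ <-] /set_mem[e _ <-]]; apply/mem_set.
  by exists 0; rewrite ?linear0.
by exists (c * d + e); rewrite ?polyCD ?polyCM ?mul_polyC ?linearP.
Qed.

Lemma DerD_subalgebra : subalgebra (@commutator F L) DerD.
Proof.
split=> [|f g Df Dg]; first exact: DerD_submod.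
by rewrite DerD_abelian //; have /set_mem := DerD_submod.1.
Qed.

Lemma Der_DerA_DerD : Der br = [set f + g | f in DerA br & g in DerD].
Proof.
apply/seteqP; split=> [f /DerP[p ->]|_ [f /DerAP[p -> _] [_ [c _ <-] <-]]].
  exists (der_of (p - (p`_0)%:P)).
    by apply/DerA_der_of; rewrite coefB coefC subrr.
  by exists (der_of (p`_0)%:P); [exists p`_0 | rewrite -linearD subrK].
by rewrite -linearD; exact: Der_der_of.
Qed.

Lemma DerA_DerD_disjoint : DerA br `&` DerD = [set 0].
Proof.
apply/seteqP; split=> [f [Af [c _ cE]]|_ ->].
  by move: Af; rewrite -cE => /DerA_der_of; rewrite coefC /= => ->; rewrite linear0.
split; first by rewrite -(linear0 der_of); apply/DerA_der_of; rewrite coef0.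
by exists 0; rewrite ?linear0.
Qed.

Lemma DerD_isomorphic : isomorphic_subalgebras (@commutator F L) DerD
  (@zero_bracket F^o) [set: F^o].
Proof.
exists (fun f => (Psi (f (Phi 1)))`_0).
have coord p : (Psi (der_of p (Phi 1)))`_0 = p`_0 by rewrite der_ofE poly_der1 PhiK.
split=> [|k _ _ [c _ <-] [d _ <-]|f g Df Dg].
- split=> [//|_ _ /set_mem[c _ <-] /set_mem[d _ <-]|c _].
    by rewrite !coord !coefC /= => ->.
  by exists (der_of c%:P); [exists c | rewrite coord coefC].
- by rewrite -linearP !coord coefD coefZ.
by rewrite DerD_abelian // -(linear0 der_of) coord coef0.
Qed.

Lemma commutator_DerD_DerA : [pchar F] =i pred0 ->
  forall d, DerD d -> d <> 0 -> [set commutator d f | f in DerA br] = DerA br.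
Proof.
move=> char0 _ [c _ <-] nz_d; have nz_c : c != 0.
  by apply/eqP => c0; apply: nz_d; rewrite c0 linear0.
apply/seteqP; split=> [_ [f Af <-]|_ /DerAP[r -> r0]].
  by have [_ _ idealA] := DerA_ideal; have [] := idealA _ _ (Der_der_of c%:P) Af.
(* This inverts [c X d/dX], which multiplies [X^i] by [c i]; at [i = 0] the
   numerator vanishes as well. *)
pose p := \poly_(i < size r) (r`_i / (c * i%:R)).
exists (der_of p).
  by apply/DerA_der_of; rewrite coef_poly r0 mul0r; case: ifP.
rewrite commutator_der_ofC; congr der_of; apply/polyP => -[|i].
  by rewrite coefZ coefXM mulr0 r0.
rewrite coefZ coefXM coef_deriv coef_poly /=; case: ltnP => le_ri; last first.
  by rewrite mul0rn mulr0 nth_default.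
have nz_i : i.+1%:R != 0 :> F by rewrite (pcharf0P F).1.
rewrite -[_ *+ i.+1]mulr_natr -mulrA mulrCA [c * (_ * _)]mulrCA.
by rewrite mulVf ?mulr1 ?mulf_neq0.
Qed.

End PolynomialModel.

Unset Implicit Arguments.

Theorem theorem0p2 (F : fieldType) (L : lmodType F)
    (br : {bilinear L -> L -> L})
    (leibL : left_leibniz br)
    (cycL : cyclic_algebra br)
    (infL : ~ finite_dimensional L) :
  [/\ ideal_of (@commutator F L) (Der br) (DerA br),
      abelian_bracket (@commutator F L) (DerA br)
    & exists D : set (L -> L),
      [/\ [/\ D `<=` Der br,
              subalgebra (@commutator F L) D
            & abelian_bracket (@commutator F L) D],
          Der br = [set f + g | f in DerA br & g in D],
          DerA br `&` D = [set 0],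
          isomorphic_subalgebras (@commutator F L) D
            (@zero_bracket F^o) [set: F^o]
        & [pchar F] =i pred0 ->
          forall d, D d -> d <> 0 ->
            [set commutator d f | f in DerA br] = DerA br]].
Proof.
have [a gen_a] := cycL.
have surj := pow_map_surj leibL gen_a.
have inj := pow_map_inj surj infL.
have [Psi PsiK] := choice surj.
have PhiK : cancel (pow_map br a) Psi by move=> p; apply: inj; rewrite PsiK.
have br_Phi := br_pow_map a leibL.
split; first exact: (DerA_ideal PhiK PsiK br_Phi).
  exact: (DerA_abelian PhiK PsiK br_Phi).
exists (DerD (pow_map br a) Psi); split.
- split; last exact: (DerD_abelian PhiK PsiK br_Phi).
    by move=> _ [c _ <-]; exact: (Der_der_of PhiK PsiK br_Phi).
  exact: (DerD_subalgebra PhiK PsiK br_Phi).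
- exact: (Der_DerA_DerD PhiK PsiK br_Phi).
- exact: (DerA_DerD_disjoint PhiK PsiK br_Phi).
- exact: (DerD_isomorphic PhiK PsiK br_Phi).
exact: (commutator_DerD_DerA PhiK PsiK br_Phi).
Qed.
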